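(* Let $G$ be a finite group and set $\delta(G)=(\zeta^G(2)-1)^{1/2}$. Then $G$ has at least $(1-\delta(G))|G|$ commutators, i.e. the set $\{x^{-1}y^{-1}xy : x,y\in G\}$ has at least $(1-\delta(G))|G|$ elements.
   Context: For a finite group $G$, $\mathrm{Irr}(G)$ denotes the set of complex irreducible characters of $G$, and $\zeta^G(s)=\sum_{\chi\in\mathrm{Irr}(G)}\chi(1)^{-s}$ for real $s$. *)

(* Defs.v *)
From mathcomp Require Import all_boot all_order all_algebra all_fingroup.
From mathcomp Require Import all_field all_character.
From mathcomp Require Import reals exp.

Set Implicit Arguments.
Unset Strict Implicit.
Unset Printing Implicit Defensive.

Import Order.TTheory GRing.Theory Num.Theory.

Local Open Scope ring_scope.

(* 'chi_i 1%g lives in algC, where real powers are not available, so the degree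
   is transported to R through its natural-number value; irr_degE shows that
   truncation loses nothing. *)
Definition irr_deg (gT : finGroupType) (G : {group gT}) (i : Iirr G) : nat :=
  Num.truncn ('chi[G]_i 1%g).

Lemma irr_degE (gT : finGroupType) (G : {group gT}) (i : Iirr G) :
  (irr_deg i)%:R = 'chi[G]_i 1%g :> algC.
Proof. by rewrite /irr_deg truncnK ?Cnat_irr1. Qed.

Definition zeta (R : realType) (gT : finGroupType) (G : {group gT}) (s : R) : R :=
  \sum_(i : Iirr G) powR (irr_deg i)%:R (- s).

Definition delta (R : realType) (gT : finGroupType) (G : {group gT}) : R :=
  Num.sqrt (zeta G 2 - 1).

Arguments zeta {R gT} G s.
Arguments delta R {gT} G.

(* Main.v *)
Require Import Defs.
From mathcomp Require Import all_boot all_order all_algebra all_fingroup.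
From mathcomp Require Import all_field all_character.
From mathcomp Require Import reals exp.

Set Implicit Arguments.
Unset Strict Implicit.
Unset Printing Implicit Defensive.

Import Order.TTheory GRing.Theory Num.Theory.

Local Open Scope ring_scope.

(** By Frobenius, [\sum_i 'chi_i g / 'chi_i 1] is, up to the factor [#|G|], the
    number of ways of writing [g] as a commutator. Its nonprincipal part
    [\sum_(i != 0) 'chi_i / 'chi_i 1] has squared norm [zeta G 2 - 1], and takes
    the value [-1] at every noncommutator; so at most [(delta R G) ^+ 2 * #|G|]
    elements are noncommutators, and [(delta R G) ^+ 2 <= delta R G] unless
    [1 < delta R G], when the bound is trivial. *)

Section Commutators.

Variables (gT : finGroupType) (G : {group gT}).

Let commutators := [set (x^-1 * y^-1 * x * y)%g | x in G, y in G].

Lemma commutators_sub : commutators \subset G.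
Proof.
by apply/subsetP => _ /imset2P[x y Gx Gy ->]; rewrite !groupM ?groupV.
Qed.

(** Up to a nonzero factor, this sum counts the pairs [(u, v)] with [u] conjugate to [x^-1], [v]
    conjugate to [x] and [u * v = g] (class multiplication coefficients). Any such product is a
    commutator, so there are none. *)
Lemma sum_irr_norm_noncommutator x g :
    x \in G -> g \in G -> g \notin commutators ->
  \sum_i `|'chi[G]_i x| ^+ 2 * ('chi_i g)^* / 'chi_i 1%g = 0.
Proof.
move=> Gx Gg ncg; have GVx : (x^-1)%g \in G by rewrite groupV.
pose K y Gy := enum_rank_in (@mem_classes _ y G Gy) (y ^: G)%g.
have valK y Gy : enum_val (@K y Gy) = (y ^: G)%g.
  by rewrite /K enum_rankK_in ?mem_classes.
have memK y Gy : y \in enum_val (@K y Gy) by rewrite valK class_refl.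
have := gring_classM_coef_sum_eq (memK _ GVx) (memK _ Gx) (memK _ Gg).
rewrite (set_gring_classM_coef _ _ (memK _ Gg)) !valK.
rewrite (_ : gring_classM_coef_set _ _ _ = set0); last first.
  apply/setP=> -[u v]; rewrite !inE /=; apply/negP => /andP[/andP[]].
  case/imsetP=> a Ga -> /imsetP[b Gb ->] /eqP Dg; case/negP: ncg.
  (* With [y = a^-1 * b], the commutator of [x ^ a] and [y] is [(x ^ a)^-1 * (x ^ a) ^ y = (x^-1) ^
     a * x ^ b]. *)
  apply/imset2P; exists (x ^ a)%g (a^-1 * b)%g; rewrite ?groupJ ?groupM ?groupV //.
  by rewrite -Dg !conjgE !invMg !invgK !mulgA !mulgK.
rewrite cards0 => /esym/eqP; rewrite !mulf_eq0 invr_eq0 !pnatr_eq0 muln_eq0.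
have class_neq0 y : (#|(y ^: G)%g| == 0)%N = false.
  apply/negbTE; rewrite -lt0n card_gt0.
  by apply/set0Pn; exists y; apply: class_refl.
rewrite !class_neq0 (negbTE (lt0n_neq0 (cardG_gt0 G))) /= => /eqP sum0.
rewrite -[RHS]sum0; apply: eq_bigr => i _.
by rewrite irr_inv normCKC.
Qed.

(** Summing the previous identity over [x] replaces each [|'chi_i x| ^+ 2] by [#|G|], since
    irreducible characters have norm 1. *)
Lemma sum_irr_noncommutator g :
    g \in G -> g \notin commutators -> \sum_i 'chi[G]_i g / 'chi_i 1%g = 0.
Proof.
move=> Gg ncg; apply: (mulfI (neq0CG G)); rewrite mulr0.
have: \sum_(x in G) \sum_i `|'chi[G]_i x| ^+ 2 * ('chi_i g)^* / 'chi_i 1%g = 0.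
  by apply: big1 => x Gx; apply: sum_irr_norm_noncommutator.
(* Conjugating the whole sum turns [('chi_i g)^*] into ['chi_i g]; the other factors are real. *)
rewrite exchange_big /= => /(congr1 Num.conj); rewrite rmorph0 rmorph_sum /= => sum0.
rewrite -[RHS]sum0 mulr_sumr; apply: eq_bigr => i _.
have norm_i : \sum_(x in G) `|'chi_i x| ^+ 2 = #|G|%:R.
  apply: (mulfI (invr_neq0 (neq0CG G))); rewrite mulVf ?neq0CG //.
  by rewrite -(cfnormE (cfun_onG _)) cfnorm_irr.
rewrite -2!mulr_suml norm_i !rmorphM /= conjCK fmorphV /= rmorph_nat.
by rewrite (CrealP (ger0_real _)) ?mulrA // ltW ?irr1_gt0.
Qed.

(** A Chebyshev-type bound: [#|G|] times the squared norm of [psi] is the sum of [|psi g| ^+ 2] over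
    [G], where each noncommutator contributes exactly 1. *)
Lemma card_noncommutators_le :
  #|G :\: commutators|%:R <=
    #|G|%:R * \sum_(i : Iirr G | i != 0) ('chi_i 1%g) ^- 2.
Proof.
pose psi : 'CF(G) := \sum_(i : Iirr G | i != 0) ('chi_i 1%g)^-1 *: 'chi_i.
have psi_noncomm g : g \in G :\: commutators -> psi g = -1.
  case/setDP=> Gg ncg; apply/eqP; rewrite -addr_eq0; apply/eqP.
  rewrite -(sum_irr_noncommutator Gg ncg) (bigD1 0) //= irr0 !cfun1E Gg group1.
  rewrite divr1 addrC sum_cfunE; congr (_ + _).
  by apply: eq_bigr => i _; rewrite cfunE mulrC.
have <-: '[psi] = \sum_(i : Iirr G | i != 0) ('chi_i 1%g) ^- 2.
  rewrite cfdot_suml; apply: eq_bigr => i nz_i.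
  rewrite cfdot_sumr (bigD1 i) //= big1 ?addr0 => [|j /andP[_ /negPf ji]].
    rewrite cfdotZl cfdotZr cfnorm_irr mulr1 fmorphV /= (CrealP (ger0_real _)).
      by rewrite -invfM -expr2.
    by rewrite ltW ?irr1_gt0.
  by rewrite cfdotZl cfdotZr cfdot_irr eq_sym ji !mulr0.
rewrite (cfnormE (cfun_onG psi)) mulVKf ?neq0CG //.
rewrite (big_setID commutators) /= -[leLHS]add0r lerD //.
  by rewrite sumr_ge0 // => g _; rewrite exprn_ge0.
rewrite (eq_bigr (fun=> 1)) => [|g ncg]; last first.
  by rewrite psi_noncomm // normrN1 expr1n.
by rewrite sumr_const.
Qed.

End Commutators.

(** The degree sum is rational, which lets the character bound in [algC] be carried over to [R]
    through [rat]. *)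
Lemma zeta2_sub1 (R : realType) (gT : finGroupType) (G : {group gT}) :
  zeta G (2 : R) - 1 = ratr (\sum_(i : Iirr G | i != 0) (irr_deg i)%:R ^- 2).
Proof.
have deg0 : irr_deg (0 : Iirr G) = 1%N by rewrite /irr_deg irr0 cfun11 truncn1.
rewrite /zeta (bigD1 0) //= deg0 powR1 addrAC subrr add0r rmorph_sum /=.
apply: eq_bigr => i _.
by rewrite (powR_invn 2) ?ler0n // fmorphV rmorphXn /= ratr_nat.
Qed.

Theorem corollary1p2 (R : realType) (gT : finGroupType) (G : {group gT}) :
  (1 - delta R G) * #|G|%:R <=
    #|[set (x^-1 * y^-1 * x * y)%g | x in G, y in G]|%:R.
Proof.
set C := [set _ | x in G, y in G].
have [lt1|le1] := ltP 1 (delta R G).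
  by apply: le_trans (ler0n _ _); rewrite mulr_le0_ge0 ?ler0n // subr_le0 ltW.
set q : rat := \sum_(i : Iirr G | i != 0) (irr_deg i)%:R ^- 2.
have q_ge0 : 0 <= q by apply: sumr_ge0 => i _; rewrite invr_ge0 exprn_ge0 ?ler0n.
(* The bound is pulled back from [algC] to [rat], since [ratr] reflects the order. *)
have rat_le : #|G :\: C|%:R <= #|G|%:R * q.
  rewrite -(ler_rat algC) rmorphM /= !ratr_nat rmorph_sum /=.
  rewrite (le_trans (card_noncommutators_le G)) // ler_wpM2l ?ler0n //.
  rewrite le_eqVlt; apply/orP; left; apply/eqP; apply: eq_bigr => i _.
  by rewrite fmorphV rmorphXn /= ratr_nat irr_degE.
have delta2 : delta R G ^+ 2 = ratr q.
  by rewrite /delta zeta2_sub1 sqr_sqrtr // ler0q.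
have noncomm_le : #|G :\: C|%:R <= delta R G * #|G|%:R.
  apply: (@le_trans _ _ (delta R G ^+ 2 * #|G|%:R)).
    by rewrite delta2 mulrC -(ratr_nat R #|G|) -rmorphM /= -(ratr_nat R) ler_rat.
  by rewrite ler_wpM2r ?ler0n // ler_piMl // sqrtr_ge0.
rewrite mulrBl mul1r lerBlDl.
rewrite -(cardsID C G) (setIidPr (commutators_sub G)) natrD addrC in noncomm_le *.
by rewrite lerD2r.
Qed.
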